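(* Let $X$ be baseline covariates with law $P(x)$, $A\in\{0,1\}$ an exposure, $L,M\in\{0,1\}$ two ordered binary mediators ($L$ preceding $M$), $Y$ a real-valued outcome, and $S_L,S_{M,0},S_{M,1}\in\{0,1\}$ (possibly unobserved) baseline variables, with potential outcomes $L(a)$, $M(a,l)$, $Y(a,l,m)$. Fix treatment levels $a,a'\in\{0,1\}$. Suppose: (1) Consistency: if $A=b$, $L=l$, $M=m$, then $L(b)=L$, $M(b,l)=M$, and $Y(b,l,m)=Y$. (2) Positivity: $P(A=b\mid X=x)>0$, $P(L=l\mid A=b,X=x)>0$, and $P(M=m\mid A=b,L=l,X=x)>0$ for all $b,l,m\in\{0,1\}$ and almost every $x$. (3) Necessity: for each $b\in\{0,1\}$, all $x$, and all $l\in\{0,1\}$, $P(L(b)=1\mid S_L=0,X=x)=0$ and $P(M(b,l)=1\mid S_{M,l}=0,X=x)=0$. (4) Sufficiency-under-reference-treatment: for all $x$ and all $l\in\{0,1\}$, $P(L(a)=1\mid S_L=1,X=x)=1$ and $P(M(a',l)=1\mid S_{M,l}=1,X=x)=1$. (5) Marker blinding and sequential marker exchangeability: for every $l\in\{0,1\}$, $(S_L,S_{M,l})\perp A\mid X$ and $S_{M,l}\perp L\mid A=a',X,S_L$. (6) Marker-stratum positivity: for all $l,m\in\{0,1\}$ and all $x$ with $P(S_L=l,S_{M,l}=m\mid X=x)>0$, $P(A=a,L=l,M=m\mid X=x,S_L=l,S_{M,l}=m)>0$; and for all $l$ and $x$ with $P(S_L=l\mid X=x)>0$, $P(A=a',L=l\mid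 X=x,S_L=l)>0$. (7) Marker-conditional single-world exchangeability: for all $l,m\in\{0,1\}$, $Y(a,l,m)\perp A\mid X,S_L,S_{M,l}$; $Y(a,l,m)\perp L\mid A=a,X,S_L,S_{M,l}$; and $Y(a,l,m)\perp M\mid A=a,L=l,X,S_L,S_{M,l}$. (8) Mediator- and outcome-marker conditional independence: for every $l\in\{0,1\}$, $M\perp S_L\mid A,L,X$ and $Y\perp(S_L,S_{M,l})\mid A,L,M,X$. Then $$\mathbb{E}[Y(a,L(a),M(a',L(a)))]=\int\sum_{l=0}^1\sum_{m=0}^1\mathbb{E}[Y\mid A=a,L=l,M=m,X=x]\,P(M=m\mid A=a',L=l,X=x)\,P(L=l\mid A=a,X=x)\,dP(x).$$
   Context: All observed variables, markers and potential outcomes are random variables on one probability space. $Y(a,L(a),M(a',L(a)))$ denotes $Y(a,l,m)$ evaluated at the random values $l=L(a)$ and $m=M(a',l)$ with $l=L(a)$. $\perp$ denotes (conditional) independence. Conditional statements hold almost surely wherever the conditioning event has positive conditional probability. All displayed expectations are assumed to exist and be finite. *)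

(* Defs.v *)
From HB Require Import structures.
From mathcomp Require Import all_boot all_order all_algebra.
From mathcomp Require Import all_classical all_reals all_analysis.
From mathcomp Require Import measurable_realfun.

Set Implicit Arguments.
Unset Strict Implicit.
Unset Printing Implicit Defensive.

Import Order.TTheory GRing.Theory Num.Theory.
Import numFieldNormedType.Exports.

Local Open Scope classical_set_scope.
Local Open Scope ring_scope.

(* Conditional expectations given a random element W : Omega -> T are taken as
   functions of the value w of W, determined almost everywhere for the law
   [pushforward P W] of W. *)

Section conditioning.
Context d d' (Omega : measurableType d) (T : measurableType d') (R : realType).
Variable P : probability Omega R.
Implicit Types (E F : set Omega) (Z : Omega -> R) (W : Omega -> T) (w : T).

Definition is_cexp_ge0 (U : Omega -> \bar R) W (g : T -> \bar R) : Prop :=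
  [/\ measurable_fun [set: T] g,
      (forall w, 0 <= g w)%E &
      forall B, measurable B ->
        (\int[pushforward P W]_(w in B) g w = \int[P]_(t in W @^-1` B) U t)%E].

(* Value at w of E[U | W = w] for a measurable U >= 0, possibly infinite: no
   integrability of U is required, since a [0, +oo]-valued version always
   exists and is unique up to a null set. *)
Definition cexp_ge0 (U : Omega -> \bar R) W : T -> \bar R :=
  xget (cst 0%E) [set g | is_cexp_ge0 U W g].

(* P(E | W = w) *)
Definition cprob0 E W w : R := fine (cexp_ge0 (fun t => (\1_E t)%:E) W w).

(* P(E | F, W = w); meaningful where P(F | W = w) > 0 (and 0 elsewhere). *)
Definition cprob E F W w : R := cprob0 (E `&` F) W w / cprob0 F W w.

(* "E[Z | F, W = w] exists and is finite", i.e. E[|Z| 1_F | W = w] < +oo. *)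
Definition cexp_finite Z F W w : Prop :=
  (cexp_ge0 (fun t => (`|Z t| * \1_F t)%:E) W w < +oo)%E.

(* E[Z | F, W = w] = E[Z 1_F | W = w] / P(F | W = w), computed from the
   positive and negative parts of Z; meaningful where P(F | W = w) > 0 and
   [cexp_finite Z F W w]. *)
Definition cexp Z F W w : R :=
  (fine (cexp_ge0 (fun t => (Num.max (Z t) 0 * \1_F t)%:E) W w)
   - fine (cexp_ge0 (fun t => (Num.max (- Z t) 0 * \1_F t)%:E) W w))
  / cprob0 F W w.

(* U and V are conditionally independent given the event F and W; F = setT
   for conditioning on W only. *)
Definition cindep d1 d2 (T1 : measurableType d1) (T2 : measurableType d2)
    (U : Omega -> T1) (V : Omega -> T2) F W : Prop :=
  forall (B : set T1) (C : set T2), measurable B -> measurable C ->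
  {ae pushforward P W, forall w, 0 < cprob0 F W w ->
     cprob (U @^-1` B `&` V @^-1` C) F W w
     = cprob (U @^-1` B) F W w * cprob (V @^-1` C) F W w}.

End conditioning.

(* Main.v *)
Require Import Defs.
From HB Require Import structures.
From mathcomp Require Import all_boot all_order all_algebra.
From mathcomp Require Import all_classical all_reals all_analysis.
From mathcomp Require Import measurable_realfun.
From mathcomp Require Import ring.

Import Order.TTheory GRing.Theory Num.Theory.
Import numFieldNormedType.Exports.

Local Open Scope classical_set_scope.
Local Open Scope ring_scope.

(** Necessity and sufficiency force [L(a) = S_L] and [M(a',l) = S_{M,l}] almost
    surely, so the nested outcome is [Y(a,l,m)] on the stratum
    [S = {S_L = l, S_{M,l} = m}] and its mean is the sum over [l, m] of
    [E[Y(a,l,m) 1_S]]. Write [q E = P(E | X)] and [F = {A = a, L = l, M = m}].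
    Every conditional independence, whatever it conditions on besides [X], can
    be rewritten on a stratum as an identity between products of functions [q]
    of [X] alone. Exchangeability, consistency and blinding of the outcome then
    give [q(Y(a,l,m) in B, S) q(F) = q(Y in B, F) q(S)] for every Borel set [B],
    which passes from sets to functions and yields
    [E[Y(a,l,m) 1_S | X] = E[Y | F, X] q(S)]; the conditions on the markers give
    [q(S) = P(M = m | A = a', L = l, X) P(L = l | A = a, X)]. *)

(** * Integrals of a function of a random element against a density *)

Section density.
Set Implicit Arguments.
Unset Strict Implicit.
Local Open Scope ereal_scope.
Context (R : realType).

Import HBNNSimple.

(** Monotone convergence along the simple approximations [g_ n] of [g]. The right-hand side sees
    [mu], [f] and [h] only through the integrals of [h] over preimages under [f]. *)
Lemma ge0_integral_densityE d d' (T : measurableType d) (S : measurableType d')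
    (mu : {measure set T -> \bar R}) (f : T -> S) (h : T -> \bar R)
    (g : S -> \bar R) (mg : measurable_fun setT g) :
  measurable_fun setT f -> measurable_fun setT h ->
  (forall x, 0 <= h x) -> (forall y, 0 <= g y) ->
  let g_ := nnsfun_approx measurableT mg in
  \int[mu]_x (g (f x) * h x) =
  limn (fun n => \sum_(r \in range (g_ n))
    (r%:E * \int[mu]_(x in f @^-1` (g_ n @^-1` [set r])) h x)).
Proof.
move=> mf mh h0 g0 g_.
have mgf n : measurable_fun setT (fun x => (g_ n (f x))%:E).
  by apply/measurable_EFinP; apply: measurableT_comp.
have -> : (fun n => \sum_(r \in range (g_ n))
    (r%:E * \int[mu]_(x in f @^-1` (g_ n @^-1` [set r])) h x)) =
  (fun n => \int[mu]_x ((g_ n (f x))%:E * h x)).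
  apply/funext => n.
  have mfr r : measurable (f @^-1` (g_ n @^-1` [set r])).
    by rewrite -[X in measurable X]setTI; apply: mf.
  transitivity (\int[mu]_x \sum_(r \in range (g_ n))
      (r * \1_(g_ n @^-1` [set r]) (f x))%:E * h x); last first.
    apply: eq_integral => x _.
    rewrite -ge0_mule_fsuml => [|y]; last exact: nnfun_muleindic_ge0.
    by rewrite fsumEFin // -(fimfunE _ (f x)).
  rewrite ge0_integral_fsum//; last 2 first.
  - move=> r; apply: emeasurable_funM => //; apply/measurable_EFinP.
    apply: measurable_funM => //.
    by apply: (measurableT_comp _ mf); exact: measurable_indic.
  - by move=> r x _; rewrite mule_ge0// nnfun_muleindic_ge0.
  apply: eq_fsbigr => r; rewrite inE => -[y _ yr].
  rewrite -ge0_integralZl//; last 2 first.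
  - by apply: measurable_funTS.
  - by rewrite lee_fin -yr.
  rewrite integral_mkcond; apply: eq_integral => x _.
  rewrite /patch; case: ifPn => [|].
    by rewrite inE/= => gr; rewrite indicE mem_set// mulr1.
  rewrite notin_setE/= => gr.
  by rewrite indicE memNset// mulr0 mul0e.
rewrite -monotone_convergence//; last 3 first.
- by move=> n; exact: emeasurable_funM.
- by move=> n x _; rewrite mule_ge0// lee_fin.
- move=> x _ m n mn; rewrite lee_wpmul2r// lee_fin.
  by have /lefP := nd_nnsfun_approx measurableT mg mn; exact.
apply: eq_integral => x _; apply/esym/cvg_lim => //.
have gcv : (g_ n (f x))%:E @[n --> \oo] --> g (f x).
  by apply: cvg_nnsfun_approx.
(* The form [0 * +oo] has to be kept out of the limit. If one limit factor is 0, the sequence is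
   constantly 0, since [g_ n] lies below [g]; otherwise the product of the limits is defined. *)
have [hx0|hx0] := eqVneq (h x) 0.
  by rewrite hx0 mule0; under eq_fun do rewrite mule0; exact: cvg_cst.
have [gx0|gx0] := eqVneq (g (f x)) 0.
  rewrite gx0 mul0e (_ : (fun n => _) = cst 0); first exact: cvg_cst.
  apply/funext => n /=.
  suff -> : (g_ n (f x))%:E = 0 by rewrite mul0e.
  apply/eqP; rewrite eq_le; apply/andP; split; last by rewrite lee_fin.
  by rewrite -[leRHS]gx0 nnsfun_approxE le_approx.
apply: cvgeM => //; last exact: cvg_cst.
have [gfin|gfin] := boolP (g (f x) \is a fin_num); last first.
  by rewrite mule_def_infty_neq0.
have [hfin|hfin] := boolP (h x \is a fin_num); first by rewrite mule_def_fin.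
by rewrite mule_def_neq0_infty.
Qed.

(** By the formula above, each integral depends only on the set function sending [B] to the integral
    of the density over the preimage of [B]. Two spaces are allowed, so that an integral over the
    law of a random element can be compared with one over [P]. *)
Lemma ge0_integral_density_ext d1 d2 d' (T1 : measurableType d1)
    (T2 : measurableType d2) (S : measurableType d')
    (mu1 : {measure set T1 -> \bar R}) (mu2 : {measure set T2 -> \bar R})
    (f1 : T1 -> S) (f2 : T2 -> S) (h1 : T1 -> \bar R) (h2 : T2 -> \bar R) :
  measurable_fun setT f1 -> measurable_fun setT f2 ->
  measurable_fun setT h1 -> measurable_fun setT h2 ->
  (forall x, 0 <= h1 x) -> (forall x, 0 <= h2 x) ->
  (forall B, measurable B -> \int[mu1]_(x in f1 @^-1` B) h1 x =
                             \int[mu2]_(x in f2 @^-1` B) h2 x) ->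
  forall g : S -> \bar R, measurable_fun setT g -> (forall y, 0 <= g y) ->
  \int[mu1]_x (g (f1 x) * h1 x) = \int[mu2]_x (g (f2 x) * h2 x).
Proof.
move=> mf1 mf2 mh1 mh2 h10 h20 h12 g mg g0.
rewrite (ge0_integral_densityE _ mg)// (ge0_integral_densityE _ mg)//.
apply/congr_lim/funext => n; apply: eq_fsbigr => r _.
by rewrite h12.
Qed.

End density.

(** * Conditional expectation of an integrable variable as a Radon-Nikodym derivative *)

Section density_measure.
Set Implicit Arguments.
Unset Strict Implicit.
Local Open Scope ereal_scope.
Context (R : realType) d d' (Omega : measurableType d) (T : measurableType d').
Variables (P : probability Omega R) (W : {mfun Omega >-> T}).
Variable U : Omega -> \bar R.
Hypotheses (iU : P.-integrable setT U) (U0 : forall t, 0 <= U t).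

(** The image under [W] of the measure with density [U]. The two proofs are arguments so that the
    measure instances built from them can be attached to this term. *)
Definition density_measure of P.-integrable setT U & (forall t, 0 <= U t) :=
  fun B : set T => \int[P]_(t in W @^-1` B) U t.

Local Notation nu := (density_measure iU U0).

Let mU : measurable_fun setT U. Proof. exact: measurable_int iU. Qed.

Let mW (B : set T) : measurable B -> measurable (W @^-1` B).
Proof. exact: measurable_funPTI. Qed.

Let dm0 : nu set0 = 0.
Proof. by rewrite /density_measure preimage_set0 integral_set0. Qed.

Let dm_ge0 B : 0 <= nu B.
Proof. exact: integral_ge0. Qed.

Let dm_sigma_additive : semi_sigma_additive nu.
Proof.
move=> F mF tF mUF; rewrite /density_measure preimage_bigcup.
apply: (semi_sigma_additive_nng_induced mU U0).
- by move=> n; exact: mW.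
- apply/trivIsetP => /= i j _ _ ij; rewrite -preimage_setI.
  by move/trivIsetP : tF => /(_ _ _ _ _ ij) ->//; rewrite preimage_set0.
- by rewrite -preimage_bigcup; exact: mW.
Qed.

HB.instance Definition _ := isMeasure.Build _ _ _ nu
  dm0 dm_ge0 dm_sigma_additive.

Let dm_fin : fin_num_fun nu.
Proof.
move=> B mB; apply: integrable_fin_num; first exact: mW.
by apply: integrableS iU => //; exact: mW.
Qed.

HB.instance Definition _ := Measure_isFinite.Build _ _ _ nu dm_fin.

Lemma density_measure_dominates : nu `<< distribution P W.
Proof.
apply/null_content_dominatesP => B mB /= PB.
apply: null_set_integral => //; first exact: mW.
exact: measurable_funTS.
Qed.

Lemma is_cexp_ge0_integrable : exists g, is_cexp_ge0 P U W g.
Proof.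
have [g [g0 gfin ig gE]] := radon_nikodym_sigma_finite density_measure_dominates.
exists g; split => //; first exact: measurable_int ig.
by move=> B mB; rewrite -[RHS]/(nu B) gE.
Qed.

End density_measure.

(** * Conditional expectation of a nonnegative variable *)

Section cexp_ge0.
Set Implicit Arguments.
Unset Strict Implicit.
Local Open Scope ereal_scope.
Context (R : realType) d d' (Omega : measurableType d) (T : measurableType d').
Variables (P : probability Omega R) (W : {mfun Omega >-> T}).
Implicit Types U : Omega -> \bar R.

(* [U] need not be integrable: cut it along the sets [k - 1 <= U < k] and sum the versions. *)
Lemma is_cexp_ge0_exists U : measurable_fun setT U ->
  (forall t, 0 <= U t) -> (forall t, U t < +oo) ->
  exists g, is_cexp_ge0 P U W g.
Proof.
move=> mU U0 Uoo.
pose F (k : nat) := [set t | U t < k%:R%:E].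
have mF k : measurable (F k).
  by rewrite -[F k]setTI; exact: emeasurable_fun_infty_o.
pose E := seqDU F.
have mE k : measurable (E k).
  by apply: measurableD => //; exact: bigsetU_measurable.
have UE : \bigcup_k E k = setT.
  rewrite -seqDU_bigcup_eq; apply/seteqP; split => // t _.
  have Ufin : U t \is a fin_num by rewrite ge0_fin_numE.
  exists (Num.bound (fine (U t))) => //; rewrite /F/= -(fineK Ufin) lte_fin.
  by rewrite archi_boundP// fine_ge0.
have tE : trivIset setT E := trivIset_seqDU F.
have Uk0 k t : 0 <= (U \_ (E k)) t by apply: erestrict_ge0.
have mUk k : measurable_fun setT (U \_ (E k)).
  by apply/(measurable_restrictT _ _).1 => //; exact: measurable_funTS.
have iUk k : P.-integrable setT (U \_ (E k)).
  apply/integrableP; split => //.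
  apply: (@le_lt_trans _ _ (\int[P]_x (cst k%:R%:E) x)); last first.
    by rewrite integral_cst// ltey_eq fin_numM// fin_num_measure.
  apply: ge0_le_integral => //; first exact: measurableT_comp.
  move=> t _; rewrite gee0_abs// patchE; case: ifPn => [|_]; last by rewrite lee_fin.
  by rewrite inE => -[+ _]; rewrite /F/= => /ltW.
have {iUk} /choice[g gP] k := is_cexp_ge0_integrable W (iUk k) (Uk0 k).
have mg k : measurable_fun setT (g k) by have [] := gP k.
have g0 k w : 0 <= g k w by have [_ + _] := gP k; exact.
exists (fun w => \sum_(k <oo) g k w); split.
- by apply: ge0_emeasurable_sum.
- by move=> w; exact: nneseries_ge0.
move=> B mB.
have mWB : measurable (W @^-1` B) by exact: measurable_funPTI.
rewrite -[LHS]/(\int[distribution P W]_(w in B) \sum_(k <oo) g k w).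
rewrite integral_nneseries//; last by move=> k; exact: measurable_funTS.
transitivity (\sum_(k <oo) \int[P]_(t in W @^-1` B `&` E k) U t).
  apply: eq_eseriesr => k _; have [_ _ ->//] := gP k.
  by rewrite [RHS]integral_mkcondr.
rewrite -ge0_integral_bigcup//.
- by rewrite -setI_bigcupr UE setIT.
- by move=> k; exact: measurableI.
- exact: measurable_funTS.
- exact: trivIset_setIl.
Qed.

(** Existence ensures that [xget] picks a version and not its default. *)
Lemma cexp_ge0P U : measurable_fun setT U ->
  (forall t, 0 <= U t) -> (forall t, U t < +oo) ->
  is_cexp_ge0 P U W (cexp_ge0 P U W).
Proof.
move=> mU U0 Uoo; rewrite /cexp_ge0.
by case: xgetP => // /(_ _ (proj2_sig (cid (is_cexp_ge0_exists mU U0 Uoo)))).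
Qed.

(** The defining property concerns indicators of events of [W]; the density comparison, with the
    identity on the law of [W], extends it to weights [h]. *)
Lemma integral_cexp_ge0 U (h : T -> \bar R) : measurable_fun setT U ->
  (forall t, 0 <= U t) -> (forall t, U t < +oo) ->
  measurable_fun setT h -> (forall w, 0 <= h w) ->
  \int[distribution P W]_w (h w * cexp_ge0 P U W w) =
  \int[P]_t (h (W t) * U t).
Proof.
move=> mU U0 Uoo mh h0; have [mg g0 gE] := cexp_ge0P mU U0 Uoo.
exact: (ge0_integral_density_ext (f1 := id)).
Qed.

End cexp_ge0.

(** * Conditional probabilities as real functions *)

Section cprob0.
Set Implicit Arguments.
Unset Strict Implicit.
Local Open Scope ereal_scope.
Context (R : realType).

(** Integrals over measurable sets determine an integrable function almost everywhere. The sets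
    enter as indicator factors, so that they can serve as the weights of [integral_cexp_ge0] and
    [integral_cprob0]. *)
Lemma ge0_ae_eq_test d (T : measurableType d) (mu : {measure set T -> \bar R})
    (f g : T -> \bar R) :
  measurable_fun setT f -> measurable_fun setT g ->
  (forall w, 0 <= f w) -> (forall w, 0 <= g w) -> \int[mu]_w f w < +oo ->
  (forall B, measurable B ->
    \int[mu]_w ((\1_B w)%:E * f w) = \int[mu]_w ((\1_B w)%:E * g w)) ->
  {ae mu, forall w, f w = g w}.
Proof.
move=> mf mg f0 g0 foo fg.
have fi : mu.-integrable setT f.
  apply/integrableP; split => //.
  by under eq_integral do rewrite gee0_abs//.
suff : ae_eq mu setT f g by apply: filterS => w; exact.
apply: integral_ae_eq => // E _ mE.
have restrictE (k : T -> \bar R) :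
    \int[mu]_(w in E) k w = \int[mu]_w ((\1_E w)%:E * k w).
  by rewrite integral_mkcond epatch_indic; apply: eq_integral => w _; rewrite muleC.
by rewrite !restrictE fg.
Qed.

Context d d' (Omega : measurableType d) (T : measurableType d').
Variables (P : probability Omega R) (W : {mfun Omega >-> T}).

Local Notation law := (distribution P W).
Local Notation ind E := (fun t => (\1_E t)%:E : \bar R).

Let mind (E : set Omega) : measurable E -> measurable_fun setT (ind E).
Proof. by move=> mE; apply/measurable_EFinP; exact: measurable_indic. Qed.

Let ind0 (E : set Omega) t : 0 <= (\1_E t)%:E :> \bar R.
Proof. by rewrite lee_fin. Qed.

Let indoo (E : set Omega) t : (\1_E t)%:E < +oo :> \bar R.
Proof. exact: ltry. Qed.

Let cexp_indP (E : set Omega) : measurable E ->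
  is_cexp_ge0 P (ind E) W (cexp_ge0 P (ind E) W).
Proof. by move=> mE; apply: cexp_ge0P => //; exact: mind. Qed.

Lemma cprob0_ge0 E w : measurable E -> (0 <= cprob0 P E W w)%R.
Proof. by move=> mE; have [_ g0 _] := cexp_indP mE; exact: fine_ge0. Qed.

Lemma measurable_cprob0 E : measurable E -> measurable_fun setT (cprob0 P E W).
Proof.
move=> mE; have [mg _ _] := cexp_indP mE.
by apply: (measurableT_comp _ mg); exact: fine_measurable.
Qed.

(** The version has integral [P E], so it is finite almost everywhere, and there [fine] loses
    nothing. *)
Lemma cprob0E E : measurable E ->
  {ae law, forall w, (cprob0 P E W w)%:E = cexp_ge0 P (ind E) W w}.
Proof.
move=> mE; have [mg g0 gE] := cexp_indP mE.
have : law.-integrable setT (cexp_ge0 P (ind E) W).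
  apply/integrableP; split => //.
  under eq_integral do rewrite gee0_abs//.
  have := gE _ measurableT; rewrite -/(distribution P W) => ->.
  by rewrite preimage_setT integral_indic// setIT ltey_eq fin_num_measure.
move=> /(integrable_ae measurableT); apply: filterS => w /(_ I) gfin.
by rewrite /cprob0 fineK.
Qed.

Lemma integral_cprob0 E (h : T -> \bar R) : measurable E ->
  measurable_fun setT h -> (forall w, 0 <= h w) ->
  \int[law]_w (h w * (cprob0 P E W w)%:E) = \int[P]_t (h (W t) * (\1_E t)%:E).
Proof.
move=> mE mh h0; rewrite -integral_cexp_ge0//; last exact: mind.
have [mg g0 gE] := cexp_indP mE.
apply: ge0_ae_eq_integral => //.
- apply: emeasurable_funM => //; apply/measurable_EFinP.
  exact: measurable_cprob0.
- exact: emeasurable_funM.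
- by move=> w _; rewrite mule_ge0// lee_fin cprob0_ge0.
- by move=> w _; rewrite mule_ge0.
by move: (cprob0E mE); apply: filterS => w -> _.
Qed.

Lemma integral_cprob0T E : measurable E ->
  \int[law]_w (cprob0 P E W w)%:E = P E.
Proof.
move=> mE; rewrite -[in RHS](setIT E) -integral_indic//.
transitivity (\int[law]_w (cst 1 w * (cprob0 P E W w)%:E)).
  by apply: eq_integral => w _; rewrite mul1e.
by rewrite integral_cprob0//; apply: eq_integral => t _; rewrite mul1e.
Qed.

(** The criterion from which identities between conditional probabilities are derived: it suffices
    to compare integrals over the events of [W]. *)
Lemma cprob0_unique E (f : T -> R) : measurable E ->
  measurable_fun setT f -> (forall w, (0 <= f w)%R) ->
  (forall B, measurable B ->
    \int[law]_w ((\1_B w)%:E * (f w)%:E) =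
    \int[P]_t ((\1_B (W t))%:E * (\1_E t)%:E)) ->
  {ae law, forall w, f w = cprob0 P E W w}.
Proof.
move=> mE mf f0 fE.
have : {ae law, forall w, (cprob0 P E W w)%:E = (f w)%:E}.
  apply: ge0_ae_eq_test.
  - by apply/measurable_EFinP; exact: measurable_cprob0.
  - exact/measurable_EFinP.
  - by move=> w; rewrite lee_fin cprob0_ge0.
  - by move=> w; rewrite lee_fin.
  - by rewrite integral_cprob0T// ltey_eq fin_num_measure.
  move=> B mB; rewrite fE//.
  rewrite (integral_cprob0 (h := fun w => (\1_B w)%:E))//.
  by apply/measurable_EFinP; exact: measurable_indic.
by apply: filterS => w [->].
Qed.

(** Carries almost sure identities on [Omega], such as consistency, over to conditional
    probabilities. *)
Lemma cprob0_ae_congr (E F : set Omega) : measurable E -> measurable F ->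
  {ae P, forall t, E t <-> F t} ->
  {ae law, forall w, cprob0 P E W w = cprob0 P F W w}.
Proof.
move=> mE mF EF; apply: cprob0_unique => //.
- exact: measurable_cprob0.
- by move=> w; exact: cprob0_ge0.
move=> B mB.
have mB1 : measurable_fun setT (fun w => (\1_B w)%:E : \bar R).
  by apply/measurable_EFinP; exact: measurable_indic.
have mBW : measurable_fun setT (fun t => (\1_B (W t))%:E : \bar R).
  exact: (measurableT_comp mB1).
rewrite (integral_cprob0 (h := fun w => (\1_B w)%:E))//.
apply: ge0_ae_eq_integral => //.
- by apply: emeasurable_funM => //; exact: mind.
- by apply: emeasurable_funM => //; exact: mind.
move: EF; apply: filterS => t EFt _; congr (_ * _%:E).
rewrite !indicE; congr (_%:R); congr nat_of_bool.
by apply/idP/idP; rewrite !inE => /EFt.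
Qed.

(** By uniqueness, the conditional probabilities of [E] and of the rest of [F] add up to that of
    [F], and the second one is nonnegative. *)
Lemma cprob0_le (E F : set Omega) : measurable E -> measurable F -> E `<=` F ->
  {ae law, forall w, (cprob0 P E W w <= cprob0 P F W w)%R}.
Proof.
move=> mE mF EF; have mFE : measurable (F `\` E) by exact: measurableD.
have mc := measurable_cprob0.
have : {ae law, forall w,
    (cprob0 P E W w + cprob0 P (F `\` E) W w)%R = cprob0 P F W w}.
  apply: cprob0_unique => //.
  - by apply: measurable_funD; exact: mc.
  - by move=> w; rewrite addr_ge0// cprob0_ge0.
  move=> B mB.
  have mB1 : measurable_fun setT (fun w => (\1_B w)%:E : \bar R).
    by apply/measurable_EFinP; exact: measurable_indic.
  have mBW : measurable_fun setT (fun t => (\1_B (W t))%:E : \bar R).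
    exact: (measurableT_comp mB1).
  under eq_integral => w _.
    rewrite EFinD ge0_muleDr ?lee_fin ?cprob0_ge0//; over.
  rewrite ge0_integralD//.
  - rewrite !(integral_cprob0 (h := fun w => (\1_B w)%:E))// -ge0_integralD//.
    + apply: eq_integral => t _; rewrite -ge0_muleDr// -EFinD; congr (_ * _%:E).
      rewrite !indicE in_setD; have [tE|tE] := boolP (t \in E).
        by rewrite /= andbF addr0 mem_set//; apply: EF; exact/set_mem.
      by rewrite andbT add0r.
    + by apply: emeasurable_funM => //; exact: mind.
    + by apply: emeasurable_funM => //; exact: mind.
  - by move=> w _; rewrite mule_ge0// lee_fin cprob0_ge0.
  - by apply: emeasurable_funM => //; apply/measurable_EFinP; exact: mc.
  - by move=> w _; rewrite mule_ge0// lee_fin cprob0_ge0.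
  - by apply: emeasurable_funM => //; apply/measurable_EFinP; exact: mc.
by apply: filterS => w <-; rewrite lerDl cprob0_ge0.
Qed.

Lemma cprob0_setT : {ae law, forall w, cprob0 P setT W w = 1%R}.
Proof.
suff : {ae law, forall w, cst 1%R w = cprob0 P setT W w}.
  by apply: filterS => w <-.
apply: cprob0_unique => // B mB.
under eq_integral do rewrite /= mule1.
rewrite (@ge0_integral_distribution _ _ _ _ _ P W (fun w => (\1_B w)%:E))//.
  by apply: eq_integral => t _; rewrite /= indicT mule1.
by apply/measurable_EFinP; exact: measurable_indic.
Qed.

Lemma cprob0_eq0 E : measurable E ->
  {ae law, forall w, cprob0 P E W w = 0%R} -> P E = 0.
Proof.
move=> mE q0; rewrite -integral_cprob0T//.
rewrite (ae_eq_integral (cst 0))//; first exact: integral0.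
- by apply/measurable_EFinP; exact: measurable_cprob0.
- by move: q0; apply: filterS => w -> _.
Qed.

End cprob0.

Lemma ae_and d (T : measurableType d) (R : realType)
    (mu : {measure set T -> \bar R}) (A B : T -> Prop) :
  {ae mu, forall x, A x} -> {ae mu, forall x, B x} ->
  {ae mu, forall x, A x /\ B x}.
Proof. exact: filterI. Qed.
Arguments ae_and {d T R mu A B}.

(** * Conditioning on a finer random element, read on a stratum *)

Section stratum.
Set Implicit Arguments.
Unset Strict Implicit.
Local Open Scope ereal_scope.
Context (R : realType) d d1 d2 (Omega : measurableType d)
  (T : measurableType d1) (T' : measurableType d2).
Variables (P : probability Omega R).
Variables (W : {mfun Omega >-> T}) (W' : {mfun Omega >-> T'}).
Variables (phi : T -> T') (psi : T' -> T) (S : set Omega) (C : set T').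
Hypotheses (mphi : measurable_fun setT phi) (mpsi : measurable_fun setT psi).
Hypotheses (mC : measurable C) (SC : forall t, S t <-> C (W' t)).
Hypotheses (psiW : forall t, psi (W' t) = W t).
Hypotheses (phiW : forall t, S t -> W' t = phi (W t)).

Let mS : measurable S.
Proof.
rewrite (_ : S = W' @^-1` C); first exact: measurable_funPTI.
by apply/seteqP; split => t /SC.
Qed.

Let mind1 d0 (T0 : measurableType d0) (E : set T0) :
  measurable E -> measurable_fun setT (fun t => (\1_E t)%:E : \bar R).
Proof. by move=> mE; apply/measurable_EFinP; exact: measurable_indic. Qed.

(** [W'] refines [W] through [psi], and on [S], itself an event of [W'], it is recovered from [W] by
    [phi]. So on [S] the variable [P(E | W')] is a function of [W] and can be pulled out when
    conditioning on [W]. *)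
Lemma cprob0_stratum E : measurable E ->
  {ae distribution P W, forall w,
    (cprob0 P E W' (phi w) * cprob0 P S W w)%R = cprob0 P (E `&` S) W w}.
Proof.
move=> mE.
have mq : measurable_fun setT (cprob0 P E W') by exact: measurable_cprob0.
have mqphi : measurable_fun setT (fun w => cprob0 P E W' (phi w)).
  exact: measurableT_comp.
apply: cprob0_unique.
- exact: measurableI.
- by apply: measurable_funM => //; exact: measurable_cprob0.
- by move=> w; rewrite mulr_ge0// cprob0_ge0.
move=> B mB.
pose h1 w := (\1_B w)%:E * (cprob0 P E W' (phi w))%:E.
have -> : \int[distribution P W]_w
    ((\1_B w)%:E * (cprob0 P E W' (phi w) * cprob0 P S W w)%:E) =
  \int[distribution P W]_w (h1 w * (cprob0 P S W w)%:E).
  by apply: eq_integral => w _; rewrite EFinM muleA.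
rewrite integral_cprob0//; last 2 first.
- by apply: emeasurable_funM; [exact: mind1|exact/measurable_EFinP].
- by move=> w; rewrite mule_ge0// lee_fin// cprob0_ge0.
have mpB : measurable (psi @^-1` B).
  by rewrite -[X in measurable X]setTI; exact: mpsi.
have mD : measurable (psi @^-1` B `&` C) by exact: measurableI.
(* [psi] and [C] turn membership of [W] in [B] and the event [S] into tests on [W'], so that the
   defining property of [P(E | W')] applies. *)
pose h2 w' := (\1_(psi @^-1` B `&` C) w')%:E * (cprob0 P E W' w')%:E.
transitivity (\int[P]_t (h2 (W' t))).
  apply: eq_integral => t _; rewrite /h1 /h2 !indicE in_setI.
  have -> : (W' t \in psi @^-1` B) = (W t \in B).
    by apply/idP/idP; rewrite !inE /= psiW.
  have -> : (W' t \in C) = (t \in S) by apply/idP/idP; rewrite !inE => /SC.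
  have [tS|tS] := boolP (t \in S); last by rewrite andbF mule0 mul0e.
  by rewrite andbT mule1 phiW//; exact: set_mem.
rewrite -(@ge0_integral_distribution _ _ _ _ _ P W' h2); last 2 first.
- by apply: emeasurable_funM; [exact: mind1|exact/measurable_EFinP].
- by move=> w; rewrite mule_ge0// lee_fin// cprob0_ge0.
rewrite (@integral_cprob0 _ _ _ _ _ P _ _ (fun w' => (\1_(psi @^-1` B `&` C) w')%:E))//.
  apply: eq_integral => t _; rewrite -!EFinM !indicE !in_setI.
  have -> : (W' t \in psi @^-1` B) = (W t \in B).
    by apply/idP/idP; rewrite !inE /= psiW.
  have -> : (W' t \in C) = (t \in S) by apply/idP/idP; rewrite !inE => /SC.
  by do 3 case: (_ \in _); rewrite /= ?(mulr0, mulr1, mul0r).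
exact: mind1.
Qed.

(** Let [N] be null for the law of [W']. On [S], [phi (W t)] lies in [N] only if [W' t] does, so
    [P(S | W)] has integral 0 over the preimage of [N] under [phi] and vanishes almost everywhere on
    it. *)
Lemma ae_stratum (Q : T' -> Prop) : {ae distribution P W', forall w', Q w'} ->
  {ae distribution P W, forall w, (0 < cprob0 P S W w)%R -> Q (phi w)}.
Proof.
move=> [N [mN N0 QN]].
have mphiN : measurable (phi @^-1` N).
  by rewrite -[X in measurable X]setTI; exact: mphi.
pose f w := (\1_(phi @^-1` N) w)%:E * (cprob0 P S W w)%:E.
have mf : measurable_fun setT f.
  apply: emeasurable_funM; first exact: mind1.
  by apply/measurable_EFinP; exact: measurable_cprob0.
have f0 w : 0 <= f w by rewrite mule_ge0// lee_fin// cprob0_ge0.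
have : \int[distribution P W]_w `|f w| = 0.
  under eq_integral do rewrite gee0_abs//.
  rewrite (@integral_cprob0 _ _ _ _ _ P _ _ (fun w => (\1_(phi @^-1` N) w)%:E))//; last first.
    exact: mind1.
  apply/eqP; rewrite eq_le; apply/andP; split; last first.
    by apply: integral_ge0 => t _; rewrite mule_ge0// lee_fin.
  have PN : P (W' @^-1` N) = 0 := N0.
  have mWN : measurable (W' @^-1` N) by exact: measurable_funPTI.
  rewrite -[leRHS]PN -[in leRHS](setIT (W' @^-1` N)) -integral_indic//.
  apply: ge0_le_integral => //.
  - apply: emeasurable_funM; last exact: mind1.
    by apply: (measurableT_comp (mind1 mphiN)).
  - exact: mind1.
  move=> t _; rewrite -EFinM lee_fin !indicE.
  have [tS|tS] := boolP (t \in S); last by rewrite mulr0.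
  rewrite mulr1 ler_nat; have [/set_mem tN|//] := boolP (W t \in _).
  by rewrite mem_set//= phiW//; exact: set_mem.
move=> /(ae_eq_integral_abs _ measurableT mf).1; apply: filterS => w /(_ I).
rewrite /f => fw Sw; apply: contrapT => nQ.
have Nw : (phi @^-1` N) w by apply: QN.
by move: fw; rewrite indicE mem_set// mul1e => -[] Sw0; rewrite Sw0 ltxx in Sw.
Qed.

(* Conditional independence given [(F, W')], read on the event [S] as a product
   formula for the conditional probabilities given [W] alone. *)
Lemma cindep_stratum d3 d4 (T3 : measurableType d3) (T4 : measurableType d4)
    (U : {mfun Omega >-> T3}) (V : {mfun Omega >-> T4}) (F : set Omega) :
  measurable F ->
  cindep P U V F W' -> forall B D, measurable B -> measurable D ->
  {ae distribution P W, forall w,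
    (cprob0 P (U @^-1` B `&` V @^-1` D `&` F `&` S) W w *
       cprob0 P (F `&` S) W w =
     cprob0 P (U @^-1` B `&` F `&` S) W w *
       cprob0 P (V @^-1` D `&` F `&` S) W w)%R}.
Proof.
move=> mF UV B D mB mD.
have mUB : measurable (U @^-1` B) by exact: measurable_funPTI.
have mVD : measurable (V @^-1` D) by exact: measurable_funPTI.
have mUF : measurable (U @^-1` B `&` F) by exact: measurableI.
have mVF : measurable (V @^-1` D `&` F) by exact: measurableI.
have mUVF : measurable (U @^-1` B `&` V @^-1` D `&` F).
  by apply: measurableI => //; exact: measurableI.
have leU := @cprob0_le _ _ _ _ _ P W _ _ (measurableI _ _ mUF mS)
  (measurableI _ _ mF mS) (@setSI _ _ _ _ (@subIsetr _ (U @^-1` B) F)).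
have eF := cprob0_stratum mF.
have eU := cprob0_stratum mUF.
have eV := cprob0_stratum mVF.
have eUV := cprob0_stratum mUVF.
have ind := ae_stratum (UV B D mB mD).
have := ae_and eF (ae_and eU (ae_and eV (ae_and eUV (ae_and ind leU)))).
apply: filterS => w [hF [hU [hV [hUV [hind hleU]]]]].
have q0 := @cprob0_ge0 _ _ _ _ _ P W _ w (measurableI _ _ mUF mS).
(* Where [P(S | W)] at [w] or [P(F | W')] at [phi w] is 0, both sides vanish; elsewhere the
   quotients in [cprob] can be cleared. *)
have := @cprob0_ge0 _ _ _ _ _ P W _ w mS; rewrite le_eqVlt => /predU1P[S0|S0].
  have F0 : cprob0 P (F `&` S) W w = 0%R by rewrite -hF -S0 mulr0.
  have U0 : cprob0 P (U @^-1` B `&` F `&` S) W w = 0%R by rewrite -hU -S0 mulr0.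
  by rewrite F0 U0 mulr0 mul0r.
have := @cprob0_ge0 _ _ _ _ _ P W' _ (phi w) mF.
rewrite le_eqVlt => /predU1P[F0|F0].
  have F1 : cprob0 P (F `&` S) W w = 0%R by rewrite -hF -F0 mul0r.
  suff -> : cprob0 P (U @^-1` B `&` F `&` S) W w = 0%R by rewrite F1 mulr0 mul0r.
  by apply/eqP; rewrite eq_le q0 andbT -F1.
have := hind S0 F0; rewrite /cprob => {}hind.
rewrite -hF -hU -hV -hUV.
have : cprob0 P F W' (phi w) != 0%R by rewrite gt_eqF.
move: hind; set u := cprob0 P _ W' _; set f := cprob0 P F _ _.
set x := cprob0 P _ W' _; set y := cprob0 P _ W' _; set s := cprob0 P S W w.
move=> hind f0.
have {}hind : (u * f = x * y)%R.
  have -> : (u = (u / f) * f)%R by rewrite divfK.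
  by rewrite hind; field.
by rewrite mulrACA hind mulrACA.
Qed.

End stratum.

(** * From probabilities of outcome events to expectations of functions of the outcome *)

Section outcome_transfer.
Set Implicit Arguments.
Unset Strict Implicit.
Local Open Scope ereal_scope.
Context (R : realType) d d' (Omega : measurableType d) (T : measurableType d').
Variables (P : probability Omega R) (X : {mfun Omega >-> T}).

Local Notation law := (distribution P X).
Local Notation q E := (cprob0 P E X).

Let mind1 d0 (T0 : measurableType d0) (E : set T0) :
  measurable E -> measurable_fun setT (fun t => (\1_E t)%:E : \bar R).
Proof. by move=> mE; apply/measurable_EFinP; exact: measurable_indic. Qed.

Let mq (E : set Omega) : measurable E -> measurable_fun setT (fun x => (q E x)%:E).
Proof. by move=> mE; apply/measurable_EFinP; exact: measurable_cprob0. Qed.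

(** The product formula for indicators extends to nonnegative [f]: tested against events of [X], the
    two sides become integrals over [Omega] of [f (U t)] and [f (V t)] against densities, and these
    are compared on preimages of Borel sets, where the formula is assumed. *)
Lemma cexp_ge0_transfer (U V : Omega -> R) (S F : set Omega) (f : R -> R) :
  measurable_fun setT U -> measurable_fun setT V ->
  measurable S -> measurable F ->
  (forall B, measurable B -> {ae law, forall x,
    (q (U @^-1` B `&` S) x * q F x = q (V @^-1` B `&` F) x * q S x)%R}) ->
  measurable_fun setT f -> (forall y, (0 <= f y)%R) ->
  \int[P]_t (f (U t) * \1_S t)%:E < +oo ->
  {ae law, forall x,
    cexp_ge0 P (fun t => (f (U t) * \1_S t)%:E) X x * (q F x)%:E =
    cexp_ge0 P (fun t => (f (V t) * \1_F t)%:E) X x * (q S x)%:E}.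
Proof.
move=> mU mV mS mF UV mf f0 foo.
have mfE : measurable_fun setT (fun y => (f y)%:E) by exact/measurable_EFinP.
have me (U' : Omega -> R) (S' : set Omega) : measurable_fun setT U' -> measurable S' ->
    measurable_fun setT (fun t => (f (U' t) * \1_S' t)%:E).
  move=> mU' mS'; apply/measurable_EFinP; apply: measurable_funM.
    exact: measurableT_comp.
  exact: measurable_indic.
have e0 (U' : Omega -> R) (S' : set Omega) t : 0 <= (f (U' t) * \1_S' t)%:E.
  by rewrite lee_fin mulr_ge0.
have eoo (U' : Omega -> R) (S' : set Omega) t : (f (U' t) * \1_S' t)%:E < +oo.
  exact: ltry.
have [mg1 g10 g1E] := cexp_ge0P P X (me _ _ mU mS) (e0 U S) (eoo U S).
have [mg2 g20 g2E] := cexp_ge0P P X (me _ _ mV mF) (e0 V F) (eoo V F).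
set g1 := cexp_ge0 P _ X in mg1 g10 g1E *.
set g2 := cexp_ge0 P _ X in mg2 g20 g2E *.
apply: ge0_ae_eq_test.
- by apply: emeasurable_funM => //; exact: mq.
- by apply: emeasurable_funM => //; exact: mq.
- by move=> x; rewrite mule_ge0// lee_fin cprob0_ge0.
- by move=> x; rewrite mule_ge0// lee_fin cprob0_ge0.
- have := g1E _ measurableT; rewrite -/law preimage_setT => g1T.
  apply: le_lt_trans foo; rewrite -g1T.
  apply: ae_ge0_le_integral => //.
  + by move=> x _; rewrite mule_ge0// lee_fin cprob0_ge0.
  + by apply: emeasurable_funM => //; exact: mq.
  have := ae_and (cprob0_le P X mF measurableT (@subsetT _ F)) (cprob0_setT P X).
  apply: filterS => x [+ qT] _; rewrite qT => qF1.
  by rewrite -[leRHS]mule1 lee_wpmul2l// lee_fin.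
move=> B mB.
(* On [Omega] the factor [f (U' t)] stands alone, with everything else in the density. *)
have swap (U' : Omega -> R) (S' F' : set Omega) :
    measurable_fun setT U' -> measurable S' -> measurable F' ->
    \int[law]_x ((\1_B x)%:E *
      (cexp_ge0 P (fun t => (f (U' t) * \1_S' t)%:E) X x * (q F' x)%:E)) =
    \int[P]_t ((f (U' t))%:E *
      ((\1_B (X t))%:E * (q F' (X t))%:E * (\1_S' t)%:E)).
  move=> mU' mS' mF'.
  rewrite [LHS](_ : _ = \int[law]_x (((\1_B x)%:E * (q F' x)%:E) *
      cexp_ge0 P (fun t => (f (U' t) * \1_S' t)%:E) X x)); last first.
    by apply: eq_integral => x _; rewrite -muleA [in RHS](muleC (q F' x)%:E).
  rewrite (@integral_cexp_ge0 _ _ _ _ _ P X _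
    (fun x => (\1_B x)%:E * (q F' x)%:E))//.
  - by apply: eq_integral => t _; rewrite EFinM muleCA.
  - exact: me.
  - by apply: emeasurable_funM; [exact: mind1|exact: mq].
  - by move=> x; rewrite mule_ge0// lee_fin// cprob0_ge0.
rewrite !swap//.
have mh (S' F' : set Omega) : measurable S' -> measurable F' ->
    measurable_fun setT
      (fun t => (\1_B (X t))%:E * (q F' (X t))%:E * (\1_S' t)%:E).
  move=> mS' mF'; apply: emeasurable_funM; last exact: mind1.
  apply: emeasurable_funM; first exact: (measurableT_comp (mind1 mB)).
  exact: (measurableT_comp (mq mF')).
have h0 (S' F' : set Omega) t : measurable F' ->
    0 <= (\1_B (X t))%:E * (q F' (X t))%:E * (\1_S' t)%:E.
  by move=> mF'; rewrite !mule_ge0// lee_fin// cprob0_ge0.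
apply: (@ge0_integral_density_ext _ _ _ _ _ _ _ P P U V _ _ mU mV
  (mh S F mS mF) (mh F S mF mS) _ _ _ (fun y => (f y)%:E)) => //.
- by move=> t; exact: h0.
- by move=> t; exact: h0.
move=> D mD.
have mpre (U' : Omega -> R) : measurable_fun setT U' -> measurable (U' @^-1` D).
  by move=> mU'; rewrite -[X in measurable X]setTI; exact: mU'.
(* On the preimage of [D] one returns to the law of [X], where [UV] applies. *)
have toX (U' : Omega -> R) (S' F' : set Omega) :
    measurable_fun setT U' -> measurable S' -> measurable F' ->
    \int[P]_(t in U' @^-1` D)
      ((\1_B (X t))%:E * (q F' (X t))%:E * (\1_S' t)%:E) =
    \int[law]_x ((\1_B x)%:E * (q F' x)%:E * (q (U' @^-1` D `&` S') x)%:E).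
  move=> mU' mS' mF'.
  rewrite (@integral_cprob0 _ _ _ _ _ P X _
    (fun x => (\1_B x)%:E * (q F' x)%:E)).
  - rewrite integral_mkcond; apply: eq_integral => t _.
    rewrite epatch_indic /= -[LHS]muleA -!EFinM; congr ((_ * _)%:E).
    by rewrite !indicE in_setI mulrC; do 2 case: (_ \in _);
      rewrite ?(mulr0, mulr1, mul0r).
  - by apply: measurableI => //; exact: mpre.
  - by apply: emeasurable_funM; [exact: mind1|exact: mq].
  - by move=> x; rewrite mule_ge0// lee_fin// cprob0_ge0.
have mUS : measurable (U @^-1` D `&` S) by apply: measurableI => //; exact: mpre.
have mVF : measurable (V @^-1` D `&` F) by apply: measurableI => //; exact: mpre.
have mBqq E1 E2 : measurable E1 -> measurable E2 ->
    measurable_fun setT (fun x => (\1_B x)%:E * (q E1 x)%:E * (q E2 x)%:E).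
  move=> mE1 mE2; apply: emeasurable_funM; last exact: mq.
  by apply: emeasurable_funM; [exact: mind1|exact: mq].
rewrite (toX _ _ _ mU mS mF) (toX _ _ _ mV mF mS).
apply: ae_eq_integral => //.
- exact: mBqq.
- exact: mBqq.
apply: filterS (UV D mD) => x UVx _.
by rewrite -!EFinM -!mulrA (mulrC (q F x)) UVx (mulrC (q S x)).
Qed.

Lemma integral_fine_cexp_ge0 (U : Omega -> R) : measurable_fun setT U ->
  (forall t, (0 <= U t)%R) -> \int[P]_t (U t)%:E < +oo ->
  [/\ {ae law, forall x, cexp_ge0 P (EFin \o U) X x \is a fin_num},
      law.-integrable setT (EFin \o fine \o cexp_ge0 P (EFin \o U) X) &
      \int[law]_x (fine (cexp_ge0 P (EFin \o U) X x))%:E = \int[P]_t (U t)%:E].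
Proof.
move=> mU U0 Uoo.
have mEU : measurable_fun setT (EFin \o U) by exact/measurable_EFinP.
have EU0 t : 0 <= (EFin \o U) t by rewrite lee_fin.
have EUoo t : (EFin \o U) t < +oo by exact: ltry.
have [mg g0 gE] := cexp_ge0P P X mEU EU0 EUoo.
set g := cexp_ge0 P _ X in mg g0 gE *.
have := gE _ measurableT; rewrite -/law preimage_setT => gT.
have ig : law.-integrable setT g.
  apply/integrableP; split => //.
  by under eq_integral do rewrite gee0_abs//; rewrite gT.
have gfin : {ae law, forall x, g x \is a fin_num}.
  by apply: filterS (integrable_ae measurableT ig) => x; exact.
have mfg : measurable_fun setT (EFin \o fine \o g).
  by apply/measurable_EFinP; apply: (measurableT_comp _ mg); exact: fine_measurable.
have fgE : ae_eq law setT g (EFin \o fine \o g).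
  by apply: filterS gfin => x gx _; rewrite /= fineK.
have fgI : \int[law]_x (fine (g x))%:E = \int[P]_t (U t)%:E.
  by rewrite -gT; apply/esym; exact: ae_eq_integral.
split => //; apply/integrableP; split => //.
by under eq_integral do rewrite /= ger0_norm ?fine_ge0//; rewrite fgI.
Qed.

(** For [s > 0] the equation forces [e2] to be finite. For [s = 0] it forces [e1 = 0], and both
    sides vanish whatever [fine e2] is. *)
Lemma fine_mul_eq (e1 e2 : \bar R) (r s : R) : 0 <= e1 -> 0 <= e2 ->
  e1 \is a fin_num -> (0 < r)%R -> (0 <= s)%R ->
  e1 * r%:E = e2 * s%:E -> (fine e2 / r * s = fine e1)%R.
Proof.
move=> e10 e20 /fineK <- r0; rewrite le_eqVlt => /predU1P[<-|s0].
  rewrite mule0 -EFinM => -[] /eqP; rewrite mulf_eq0 (gt_eqF r0) orbF => /eqP -> /=.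
  by rewrite mulr0.
case: e2 e20 => [e2| |] //= e20.
  have rn : r != 0%R by rewrite gt_eqF.
  by move=> [] h; apply: (mulIf rn); rewrite h mulrAC divfK.
by rewrite gt0_mulye.
Qed.

End outcome_transfer.

(** * Almost sure equality of potential mediators and markers *)

Section markers.
Set Implicit Arguments.
Unset Strict Implicit.
Context (R : realType) d d' (Omega : measurableType d) (T : measurableType d').
Variables (P : probability Omega R) (X : {mfun Omega >-> T}).

Lemma cprobTE (E : set Omega) : measurable E ->
  {ae distribution P X, forall x, cprob P E setT X x = cprob0 P E X x}.
Proof.
move=> mE; apply: filterS (cprob0_setT P X) => x qT.
by rewrite /cprob setIT qT divr1.
Qed.

(** Necessity makes [N = 1, S = 0] null; sufficiency gives [N = 1, S = 1] the full probability of
    [S = 1], so [N = 0, S = 1] is null too. Where the conditioning event has conditional probability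
    0, monotonicity settles both. *)
Lemma ae_eq_marker (N S : {mfun Omega >-> bool}) :
  {ae distribution P X, forall x,
     0 < cprob P [set t | S t = false] setT X x ->
     cprob P [set t | N t = true] [set t | S t = false] X x = 0} ->
  {ae distribution P X, forall x,
     0 < cprob P [set t | S t = true] setT X x ->
     cprob P [set t | N t = true] [set t | S t = true] X x = 1} ->
  {ae P, forall t, N t = S t}.
Proof.
move=> nec suf.
have mN b : measurable [set t | N t = b].
  by rewrite -[X in measurable X]/(N @^-1` [set b]); exact: measurable_funPTI.
have mS b : measurable [set t | S t = b].
  by rewrite -[X in measurable X]/(S @^-1` [set b]); exact: measurable_funPTI.
have mNS b c : measurable ([set t | N t = b] `&` [set t | S t = c]).
  exact: measurableI.
have P10 : P ([set t | N t = true] `&` [set t | S t = false]) = 0%E.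
  apply: (@cprob0_eq0 _ _ _ _ _ P X) => //.
  have := ae_and nec (ae_and (cprobTE (mS false))
    (cprob0_le P X (mNS true false) (mS false) (@subIsetr _ _ _))).
  apply: filterS => x [necx [qS]]; rewrite qS /cprob in necx.
  have := @cprob0_ge0 _ _ _ _ _ P X _ x (mS false); rewrite le_eqVlt => /predU1P[<-|q0].
    by move=> h; apply/eqP; rewrite eq_le h cprob0_ge0.
  move=> _; have /eqP := necx q0; rewrite mulf_eq0 invr_eq0 (gt_eqF q0) orbF.
  by move/eqP.
have P11 : P ([set t | N t = true] `&` [set t | S t = true]) =
           P [set t | S t = true].
  rewrite -(integral_cprob0T P X (mNS _ _)) -(integral_cprob0T P X (mS _)).
  apply: ae_eq_integral => //.
  - by apply/measurable_EFinP; exact: measurable_cprob0.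
  - by apply/measurable_EFinP; exact: measurable_cprob0.
  have := ae_and suf (ae_and (cprobTE (mS true))
    (cprob0_le P X (mNS true true) (mS true) (@subIsetr _ _ _))).
  apply: filterS => x [sufx [qS]] + _; rewrite qS /cprob in sufx.
  have := @cprob0_ge0 _ _ _ _ _ P X _ x (mS true); rewrite le_eqVlt => /predU1P[<-|q0].
    by move=> h; congr EFin; apply/eqP; rewrite eq_le h cprob0_ge0.
  by move=> _; congr EFin; rewrite -[RHS]mul1r -(sufx q0) divfK// gt_eqF.
have P01 : P ([set t | S t = true] `\` [set t | N t = true]) = 0%E.
  rewrite measureD//; last by rewrite ltey_eq fin_num_measure.
  rewrite [X in (_ - X)%E](_ : _ = P [set t | S t = true]).
    by rewrite subee// fin_num_measure.
  by rewrite setIC; exact: P11.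
exists (([set t | N t = true] `&` [set t | S t = false]) `|`
        ([set t | S t = true] `\` [set t | N t = true])); split.
- by apply: measurableU => //; exact: measurableD.
- apply/eqP; rewrite -measure_le0.
  apply: le_trans (measureU2 _ _ _) _ => //; first exact: measurableD.
  by rewrite -[leRHS]adde0; apply: leeD; rewrite le_eqVlt; apply/orP; left; apply/eqP; [exact: P10|exact: P01].
move=> t /=; case: (N t); case: (S t) => //; first by left.
by right; split.
Qed.

End markers.

(** * Pairs of random elements *)

Section pair_mfun.
Set Implicit Arguments.
Unset Strict Implicit.
Context d d1 d2 (Omega : measurableType d) (T1 : measurableType d1)
  (T2 : measurableType d2).
Variables (f : {mfun Omega >-> T1}) (g : {mfun Omega >-> T2}).

(** Named in order to carry a measurability instance; it unfolds to the explicit pairs in the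
    conditional independence hypotheses. *)
Definition pair_mfun := fun t => (f t, g t).

Let measurable_pair_mfun : measurable_fun setT pair_mfun.
Proof. exact: measurable_fun_pair. Qed.

HB.instance Definition _ :=
  isMeasurableFun.Build _ _ _ _ pair_mfun measurable_pair_mfun.

End pair_mfun.

(** * Algebra of the product formulas *)

Section product_formulas.
Set Implicit Arguments.
Unset Strict Implicit.
Context (R : realType).

(** All letters are conditional probabilities given [X]: [s] of [S1 = l, S2 = m], [sl] of [S1 = l],
    [A1] and [A2] of [A = a] and [A = a'], [AL] of [A = a', L = l], [w] of the latter with [M = m],
    and [k] of that with [S1 = l]. Then [LA / A1 = sl] and [w / AL = k / slAL = s / sl]; if
    [sl = 0], then [s = 0] as well. *)
Lemma weight_product_formula (s sl A1 A2 sA2 slA1 slA2 w AL k slAL LA : R) :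
  0 < A1 -> 0 < A2 -> 0 < AL -> 0 <= s -> s <= sl ->
  sA2 = s * A2 -> slA2 = sl * A2 -> slA1 = sl * A1 ->
  LA = slA1 -> k * slA2 = sA2 * slAL -> k * AL = w * slAL ->
  (0 < sl -> 0 < slAL) ->
  w / AL * (LA / A1) = s.
Proof.
move=> A1p A2p ALp s0 ssl sA2E slA2E slA1E -> kE wE pos.
have A1n : A1 != 0 by rewrite gt_eqF.
have A2n : A2 != 0 by rewrite gt_eqF.
have ALn : AL != 0 by rewrite gt_eqF.
rewrite slA1E mulfK//.
have [sl0|sl0] := leP sl 0.
  have -> : s = 0 by apply/eqP; rewrite eq_le s0 (le_trans ssl sl0).
  have -> : sl = 0 by apply/eqP; rewrite eq_le sl0 (le_trans s0 ssl).
  by rewrite mulr0.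
have slALn : slAL != 0 by rewrite gt_eqF// pos.
have sln : sl != 0 by rewrite gt_eqF.
have ks : k * sl = s * slAL.
  by apply: (mulIf A2n); rewrite -mulrA -slA2E kE sA2E mulrAC.
have -> : w = k * AL / slAL by rewrite wE mulfK.
have -> : k = s * slAL / sl by rewrite -ks mulfK.
by field; rewrite ALn slALn sln.
Qed.

(** [s] belongs to the stratum, and a prefix [y] adds the outcome event. [e1] to [e3] carry the
    ratio [yS / s] to [yFS / FS] one conditioning at a time, and [e4] compares the latter with [yF]
    and [F]. For [s = 0] both sides vanish; for [s > 0] positivity of [FS] climbs to all
    denominators. *)
Lemma outcome_product_formula (s AS LAS FS yS yAS yLAS yFS F yF : R) :
  0 <= s -> 0 <= yS -> yS <= s -> AS <= s -> LAS <= AS -> FS <= LAS ->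
  (0 < s -> 0 < FS) ->
  yAS * s = yS * AS -> yLAS * AS = yAS * LAS -> yFS * LAS = yLAS * FS ->
  yFS * F = yF * FS ->
  yS * F = yF * s.
Proof.
move=> s0 yS0 ySs _ LA FL pos e1 e2 e3 e4.
move: s0; rewrite le_eqVlt => /predU1P[s0|s0].
  have -> : yS = 0 by apply/eqP; rewrite eq_le yS0 andbT s0.
  by rewrite -s0 mul0r mulr0.
have FSp := pos s0.
have LASp := lt_le_trans FSp FL.
have ASp := lt_le_trans LASp LA.
have sn : s != 0 by rewrite gt_eqF.
have FSn : FS != 0 by rewrite gt_eqF.
have LASn : LAS != 0 by rewrite gt_eqF.
have ASn : AS != 0 by rewrite gt_eqF.
have e5 : yS = yAS * s / AS by rewrite e1 mulfK.
have e6 : yAS = yLAS * AS / LAS by rewrite e2 mulfK.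
have e7 : yLAS = yFS * LAS / FS by rewrite e3 mulfK.
have e8 : yF = yFS * F / FS by rewrite e4 mulfK.
by rewrite e5 e6 e7 e8; field; rewrite FSn LASn ASn.
Qed.

End product_formulas.

(** * Product formulas on the strata of the markers *)

Section strata.
Set Implicit Arguments.
Unset Strict Implicit.
Context (R : realType) d dX (Omega : measurableType d) (TX : measurableType dX).
Variables (P : probability Omega R) (X : {mfun Omega >-> TX}).
Variables (A L M S1 S2 : {mfun Omega >-> bool}).
Local Notation law := (distribution P X).
Local Notation q E := (cprob0 P E X).
Local Notation "V =: b" := [set t | V t = b] (at level 40).

Let mV (V : {mfun Omega >-> bool}) b : measurable (V =: b).
Proof.
by rewrite -[X in measurable X]/(V @^-1` [set b]); exact: measurable_funPTI.
Qed.

Let mb (B : set bool) : measurable B. Proof. by []. Qed.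

Ltac msets := repeat first [exact: mV | apply: measurableI | exact: measurableT].
Ltac seteq := apply/seteqP; split => t /=; clear; tauto.
(** Closes a goal that agrees with [H] up to the order and grouping of intersections. *)
Ltac eq_up_to_sets H :=
  apply: etrans; [|apply: etrans; [exact H|]];
  try congr (_ * _); congr (cprob0 _ _ _ _); seteq.

Lemma blindingE (a l m : bool) :
  cindep P (fun t => (S1 t, S2 t)) A setT X ->
  {ae law, forall x, q (S1 =: l `&` S2 =: m `&` A =: a) x =
     q (S1 =: l `&` S2 =: m) x * q (A =: a) x} /\
  {ae law, forall x, q (S1 =: l `&` A =: a) x =
     q (S1 =: l) x * q (A =: a) x}.
Proof.
move=> blind.
have H (B : set (bool * bool)) : measurable B ->
    {ae law, forall x,
      q ((fun t => (S1 t, S2 t)) @^-1` B `&` A =: a) x =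
      q ((fun t => (S1 t, S2 t)) @^-1` B) x * q (A =: a) x}.
  move=> mB.
  (* Conditioning is on [X] alone, so the stratum is [setT], of conditional probability 1. *)
  have := ae_and (cprob0_setT P X)
    (@cindep_stratum _ _ _ _ _ _ _ P X X id id setT setT
    (@measurable_id _ _ _) (@measurable_id _ _ _) measurableT
    (fun t => iff_refl _) (fun=> erefl) (fun _ _ => erefl) _ _ _ _
    (pair_mfun S1 S2) A setT measurableT blind B [set a] mB (mb _)).
  by apply: filterS => x []; rewrite !setIT => -> ; rewrite mulr1.
split.
  exact: H (measurableX (mb [set l]) (mb [set m])).
have := H _ (measurableX (mb [set l]) (mb setT)).
by apply: filterS => x Hx; eq_up_to_sets Hx.
Qed.

(** The stratum is [S1 = l], on which [(X, S1)] is a function of [X]. *)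
Lemma exchangeable_markerE (a l m : bool) :
  cindep P S2 L (A =: a) (fun t => (X t, S1 t)) ->
  {ae law, forall x,
    q (S2 =: m `&` L =: l `&` A =: a `&` S1 =: l) x *
      q (A =: a `&` S1 =: l) x =
    q (S1 =: l `&` S2 =: m `&` A =: a) x *
      q (A =: a `&` L =: l `&` S1 =: l) x}.
Proof.
move=> ind.
have mC : measurable ([set: TX] `*` [set l]) by exact: measurableX.
have SC t : (S1 =: l) t <-> ([set: TX] `*` [set l]) (pair_mfun X S1 t).
  by split => [?|[]].
have mphi : measurable_fun setT (fun x : TX => (x, l)).
  by apply: measurable_fun_pair => //; exact: measurable_id.
have phiW t : (S1 =: l) t -> pair_mfun X S1 t = (X t, l).
  by rewrite /pair_mfun => /= ->.
have := @cindep_stratum _ _ _ _ _ _ _ P X (pair_mfun X S1) (fun x => (x, l))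
  fst (S1 =: l) ([set: TX] `*` [set l]) mphi measurable_fst mC SC
  (fun=> erefl) phiW _ _ _ _ S2 L (A =: a) (mV A a) ind [set m] [set l]
  (mb _) (mb _).
by apply: filterS => x Hx; eq_up_to_sets Hx.
Qed.

(** The stratum is [A = a, L = l], on which [(A, L, X)] is a function of [X]. *)
Lemma mediator_markerE (a l m : bool) :
  cindep P M S1 setT (fun t => (A t, L t, X t)) ->
  {ae law, forall x,
    q (M =: m `&` S1 =: l `&` (A =: a `&` L =: l)) x *
      q (A =: a `&` L =: l) x =
    q (M =: m `&` (A =: a `&` L =: l)) x *
      q (A =: a `&` L =: l `&` S1 =: l) x}.
Proof.
move=> ind; set C := [set a] `*` [set l] `*` [set: TX].
pose W := pair_mfun (pair_mfun A L) X.
have mC : measurable C by do 2 apply: measurableX => //.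
have SC t : (A =: a `&` L =: l) t <-> C (W t) by split => [[]|[[]]].
have mphi : measurable_fun setT (fun x : TX => (a, l, x)).
  by apply: measurable_fun_pair => //; exact: measurable_id.
have phiW t : (A =: a `&` L =: l) t -> W t = (a, l, X t).
  by move=> [At Lt]; rewrite -[LHS]/(A t, L t, X t) At Lt.
have mS : measurable (A =: a `&` L =: l) by msets.
have := @cindep_stratum _ _ _ _ _ _ _ P X W (fun x => (a, l, x)) snd _ C
  mphi measurable_snd mC SC (fun=> erefl) phiW _ _ _ _ M S1 setT measurableT
  ind [set m] [set l] (mb _) (mb _).
by apply: filterS => x Hx; eq_up_to_sets Hx.
Qed.

(** Given [X], [P(L = l | A = a)] is [P(S1 = l)] by consistency and blinding, and
    [P(M = m | A = a', L = l)] is [P(S2 = m | S1 = l)]: [S1 = l] is inserted by mediator-marker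
    independence, [M] becomes [S2] by consistency, then [L] is dropped by marker exchangeability and
    [A] by blinding. *)
Lemma stratum_weight (a a' l m : bool) :
  cindep P (fun t => (S1 t, S2 t)) A setT X ->
  cindep P S2 L (A =: a') (fun t => (X t, S1 t)) ->
  cindep P M S1 setT (fun t => (A t, L t, X t)) ->
  {ae P, forall t, A t = a -> L t = S1 t} ->
  {ae P, forall t, A t = a' -> L t = l -> M t = S2 t} ->
  {ae law, forall x, 0 < q (A =: a) x} ->
  {ae law, forall x, 0 < q (A =: a') x} ->
  {ae law, forall x, 0 < q (A =: a' `&` L =: l) x} ->
  {ae law, forall x, 0 < q (S1 =: l) x -> 0 < q (A =: a' `&` L =: l `&` S1 =: l) x} ->
  {ae law, forall x,
    q (M =: m `&` (A =: a' `&` L =: l)) x / q (A =: a' `&` L =: l) x *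
      (q (L =: l `&` A =: a) x / q (A =: a) x) = q (S1 =: l `&` S2 =: m) x}.
Proof.
move=> blind exch med consL consM posA posA' posL strat.
have [bS bS1'] := blindingE a' l m blind.
have [_ bS1] := blindingE a l m blind.
have eS := exchangeable_markerE l m exch.
have eM := mediator_markerE a' l m med.
have mLA : measurable (L =: l `&` A =: a) by msets.
have mSA : measurable (S1 =: l `&` A =: a) by msets.
have cL : {ae law, forall x,
    q (L =: l `&` A =: a) x = q (S1 =: l `&` A =: a) x}.
  apply: cprob0_ae_congr => //.
  by apply: filterS consL => t /= tE; split => -[h At]; split=> //; rewrite -h tE.
have mSL : measurable (S2 =: m `&` L =: l `&` A =: a' `&` S1 =: l) by msets.
have mML : measurable (M =: m `&` S1 =: l `&` (A =: a' `&` L =: l)) by msets.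
have cM : {ae law, forall x,
    q (S2 =: m `&` L =: l `&` A =: a' `&` S1 =: l) x =
    q (M =: m `&` S1 =: l `&` (A =: a' `&` L =: l)) x}.
  apply: cprob0_ae_congr => //.
  apply: filterS consM => t /= tE; split.
    by move=> [[[S2t Lt] At] S1t]; rewrite tE.
  by move=> [[Mt S1t] [At Lt]]; rewrite -tE.
have mS : measurable (S1 =: l `&` S2 =: m) by msets.
have leS := cprob0_le P X mS (mV S1 l) (@subIsetl _ _ _).
have := ae_and posA (ae_and posA' (ae_and posL (ae_and strat (ae_and bS
  (ae_and bS1' (ae_and bS1 (ae_and eS (ae_and eM (ae_and cL (ae_and cM leS)))))))))).
apply: filterS => x [pA [pA' [pL [st [xS [xS1' [xS1 [xe [xm [xL [xM xle]]]]]]]]]]].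
rewrite xM in xe.
have swapA : q (A =: a' `&` S1 =: l) x = q (S1 =: l `&` A =: a') x by rewrite setIC.
rewrite swapA in xe.
apply: (weight_product_formula pA pA' pL (cprob0_ge0 P X x mS) xle xS xS1' xS1
  xL xe xm st).
Qed.

(** * The outcome on a marker stratum *)

Section outcome.
Variables (Ya Y : {mfun Omega >-> R}) (a l m : bool).
Local Notation S := (S1 =: l `&` S2 =: m).
Local Notation F := (A =: a `&` L =: l `&` M =: m).

Let mS : measurable S. Proof. by msets. Qed.

(** One form for the three outcome exchangeabilities: [V] is [A], [L] or [M], and [G] is the event
    already conditioned on. *)
Let stratum_exchE (V : {mfun Omega >-> bool}) (b : bool) (G : set Omega)
    (B : set R) : measurable G -> measurable B ->
  cindep P Ya V G (fun t => (X t, S1 t, S2 t)) ->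
  {ae law, forall x,
    q (Ya @^-1` B `&` V =: b `&` G `&` S) x * q (G `&` S) x =
    q (Ya @^-1` B `&` G `&` S) x * q (V =: b `&` G `&` S) x}.
Proof.
move=> mG mB ind; set C := [set: TX] `*` [set l] `*` [set m].
pose W := pair_mfun (pair_mfun X S1) S2.
have mC : measurable C by do 2 apply: measurableX => //.
have SC t : S t <-> C (W t) by split => [[]|[[]]].
have mphi : measurable_fun setT (fun x : TX => (x, l, m)).
  do 2 apply: measurable_fun_pair => //; exact: measurable_id.
have phiW t : S t -> W t = (X t, l, m).
  by move=> [S1t S2t]; rewrite -[LHS]/(X t, S1 t, S2 t) S1t S2t.
have mpsi : measurable_fun setT (fun w : TX * bool * bool => w.1.1).
  by apply: (measurableT_comp measurable_fst); exact: measurable_fst.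
exact: (@cindep_stratum _ _ _ _ _ _ _ P X W (fun x => (x, l, m))
  (fun w => w.1.1) _ C mphi mpsi mC SC (fun=> erefl) phiW _ _ _ _ Ya V G mG
  ind B [set b] mB (mb _)).
Qed.

Let outcome_markerE (B : set R) : measurable B ->
  cindep P Y (fun t => (S1 t, S2 t)) setT (fun t => (A t, L t, M t, X t)) ->
  {ae law, forall x,
    q (Y @^-1` B `&` S `&` F) x * q F x = q (Y @^-1` B `&` F) x * q (S `&` F) x}.
Proof.
move=> mB ind; set C := [set a] `*` [set l] `*` [set m] `*` [set: TX].
pose W := pair_mfun (pair_mfun (pair_mfun A L) M) X.
have mC : measurable C by do 3 apply: measurableX => //.
have SC t : F t <-> C (W t) by split => [[[]]|[[[]]]].
have mphi : measurable_fun setT (fun x : TX => (a, l, m, x)).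
  by apply: measurable_fun_pair => //; exact: measurable_id.
have phiW t : F t -> W t = (a, l, m, X t).
  by move=> [[At Lt] Mt]; rewrite -[LHS]/(A t, L t, M t, X t) At Lt Mt.
have := @cindep_stratum _ _ _ _ _ _ _ P X W (fun x => (a, l, m, x)) snd _ C
  mphi measurable_snd mC SC (fun=> erefl) phiW _ _ _ _ Y (pair_mfun S1 S2) setT
  measurableT ind B _ mB (measurableX (mb [set l]) (mb [set m])).
by apply: filterS => x Hx; eq_up_to_sets Hx.
Qed.

(** Adding [A = a], [L = l], [M = m] in turn to the stratum keeps the conditional law of [Ya]; on
    [F] consistency replaces [Ya] by [Y], whose law given [F] and [X] does not depend on the
    markers. *)
Lemma stratum_outcome (B : set R) : measurable B ->
  cindep P Ya A setT (fun t => (X t, S1 t, S2 t)) ->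
  cindep P Ya L (A =: a) (fun t => (X t, S1 t, S2 t)) ->
  cindep P Ya M (A =: a `&` L =: l) (fun t => (X t, S1 t, S2 t)) ->
  cindep P Y (fun t => (S1 t, S2 t)) setT (fun t => (A t, L t, M t, X t)) ->
  {ae P, forall t, A t = a -> L t = l -> M t = m -> Ya t = Y t} ->
  {ae law, forall x, 0 < q S x -> 0 < q (F `&` S) x} ->
  {ae law, forall x, q (Ya @^-1` B `&` S) x * q F x = q (Y @^-1` B `&` F) x * q S x}.
Proof.
move=> mB iA iL iM iY cons strat.
have mYa : measurable (Ya @^-1` B) by exact: measurable_funPTI.
have mY : measurable (Y @^-1` B) by exact: measurable_funPTI.
have eA := stratum_exchE a measurableT mB iA.
have eL := stratum_exchE l (mV A a) mB iL.
have mAL : measurable (A =: a `&` L =: l) by msets.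
have eM := stratum_exchE m mAL mB iM.
have eY := outcome_markerE mB iY.
have m1 : measurable (Ya @^-1` B `&` S) by exact: measurableI.
have m2 : measurable (A =: a `&` S) by msets.
have m3 : measurable (A =: a `&` L =: l `&` S) by msets.
have m4 : measurable (F `&` S) by msets.
have m5 : measurable (Ya @^-1` B `&` S `&` F) by msets.
have m6 : measurable (Y @^-1` B `&` S `&` F) by msets.
have cY : {ae law, forall x,
    q (Ya @^-1` B `&` S `&` F) x = q (Y @^-1` B `&` S `&` F) x}.
  apply: cprob0_ae_congr => //.
  by apply: filterS cons => t /= tE; split => -[[+ ?] [[? ?] ?]]; rewrite tE.
have le1 := cprob0_le P X m1 mS (@subIsetr _ _ _).
have le2 := cprob0_le P X m2 mS (@subIsetr _ _ _).
have le3 := cprob0_le P X m3 m2 (@setSI _ _ _ _ (@subIsetl _ _ _)).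
have le4 := cprob0_le P X m4 m3 (@setSI _ _ _ _ (@subIsetl _ _ _)).
have := ae_and strat (ae_and eA (ae_and eL (ae_and eM (ae_and eY (ae_and cY
  (ae_and le1 (ae_and le2 (ae_and le3 le4)))))))).
apply: filterS => x [st [xA [xL [xM [xY [xc [l1 [l2 [l3 l4]]]]]]]]].
rewrite -xc in xY.
have e1 : q (Ya @^-1` B `&` A =: a `&` S) x * q S x =
    q (Ya @^-1` B `&` S) x * q (A =: a `&` S) x by eq_up_to_sets xA.
have e2 : q (Ya @^-1` B `&` (A =: a `&` L =: l) `&` S) x * q (A =: a `&` S) x =
    q (Ya @^-1` B `&` A =: a `&` S) x * q (A =: a `&` L =: l `&` S) x.
  by eq_up_to_sets xL.
have e3 : q (Ya @^-1` B `&` S `&` F) x * q (A =: a `&` L =: l `&` S) x =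
    q (Ya @^-1` B `&` (A =: a `&` L =: l) `&` S) x * q (F `&` S) x.
  by eq_up_to_sets xM.
have e4 : q (Ya @^-1` B `&` S `&` F) x * q F x =
    q (Y @^-1` B `&` F) x * q (F `&` S) x by eq_up_to_sets xY.
exact: (outcome_product_formula (cprob0_ge0 P X x mS) (cprob0_ge0 P X x m1)
  l1 l2 l3 l4 st e1 e2 e3 e4).
Qed.

End outcome.

End strata.

(** * Measurability and integration of the terms of the formula *)

Section measurability.
Set Implicit Arguments.
Unset Strict Implicit.
Context (R : realType).

(** Used to pass from a positive [cprob] to a positive joint conditional probability. *)
Lemma numerator_gt0 (x y : R) : 0 <= x -> 0 < x / y -> 0 < x.
Proof.
by rewrite le_eqVlt => /predU1P[<-|//]; rewrite mul0r ltxx.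
Qed.

Lemma integral_sum2B d (T : measurableType d) (mu : {measure set T -> \bar R})
    (p n : bool -> bool -> T -> R) :
  (forall l m, mu.-integrable setT (EFin \o p l m)) ->
  (forall l m, mu.-integrable setT (EFin \o n l m)) ->
  (\int[mu]_x (\sum_(l : bool) \sum_(m : bool) (p l m x - n l m x))%:E =
  \sum_(l : bool) \sum_(m : bool)
     (\int[mu]_x (p l m x)%:E - \int[mu]_x (n l m x)%:E))%E.
Proof.
move=> ip in_.
have ipn l m : mu.-integrable setT ((EFin \o p l m) \- (EFin \o n l m))%E.
  exact: integrableB.
have isum l : mu.-integrable setT (fun x =>
    \sum_(m : bool) ((EFin \o p l m) \- (EFin \o n l m)) x)%E.
  by apply: integrable_sum => // m _; exact: ipn.
transitivity (\int[mu]_x (\sum_(l : bool) \sum_(m : bool)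
    ((EFin \o p l m) \- (EFin \o n l m)) x))%E.
  apply: eq_integral => x _; rewrite -sumEFin; apply: eq_bigr => l _.
  by rewrite -sumEFin.
rewrite integral_sum//; apply: eq_bigr => l _.
rewrite integral_sum//; apply: eq_bigr => m _.
by rewrite integralB.
Qed.

Context d d' (Omega : measurableType d) (T : measurableType d').
Variables (P : probability Omega R) (X : {mfun Omega >-> T}).

Lemma measurable_cprob0V E : measurable E ->
  measurable_fun setT (fun x => (cprob0 P E X x)^-1).
Proof.
move=> mE.
(* On nonnegative reals the inverse is the power [-1], also at 0, where both are 0. *)
rewrite (_ : (fun x => _) = fun x => cprob0 P E X x `^ (-1)).
  exact: (measurableT_comp (@measurable_powR R (-1)) (measurable_cprob0 P X mE)).
by apply/funext => x; rewrite powR_inv1// cprob0_ge0.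
Qed.

Lemma measurable_cprob (E F : set Omega) : measurable E -> measurable F ->
  measurable_fun setT (cprob P E F X).
Proof.
move=> mE mF; apply: measurable_funM; last exact: measurable_cprob0V.
by apply: measurable_cprob0; exact: measurableI.
Qed.

Lemma measurable_cexp (Z : Omega -> R) (F : set Omega) :
  measurable_fun setT Z -> measurable F -> measurable_fun setT (cexp P Z F X).
Proof.
move=> mZ mF; apply: measurable_funM; last exact: measurable_cprob0V.
have mfine (f : R -> R) : measurable_fun setT f -> (forall y, 0 <= f y) ->
    measurable_fun setT (fun x =>
      fine (cexp_ge0 P (fun t => (f (Z t) * \1_F t)%:E) X x)).
  move=> mf f0.
  have [] := @cexp_ge0P _ _ _ _ _ P X (fun t => (f (Z t) * \1_F t)%:E).
  - apply/measurable_EFinP; apply: measurable_funM; last exact: measurable_indic.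
    exact: measurableT_comp.
  - by move=> t; rewrite lee_fin mulr_ge0.
  - by move=> t; exact: ltry.
  by move=> mg _ _; apply: (measurableT_comp _ mg); exact: fine_measurable.
apply: measurable_funB.
- apply: (mfine (fun y => Num.max y 0)).
    exact: measurable_maxr.
  by move=> y; rewrite le_max lexx orbT.
- apply: (mfine (fun y => Num.max (- y) 0)).
    exact: measurable_maxr.
  by move=> y; rewrite le_max lexx orbT.
Qed.

End measurability.

(** * Identification of the mean nested outcome, stratum by stratum *)

Theorem theoremS2p3
  (R : realType) (d dX : measure_display)
  (Omega : measurableType d) (TX : measurableType dX)
  (P : probability Omega R)
  (X : {RV P >-> TX}) (A L M : {RV P >-> bool}) (Y : {RV P >-> R})
  (SL : {RV P >-> bool}) (SM : bool -> {RV P >-> bool})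
  (* potential outcomes L(a), M(a,l), Y(a,l,m) *)
  (Lp : bool -> {RV P >-> bool})
  (Mp : bool -> bool -> {RV P >-> bool})
  (Yp : bool -> bool -> bool -> {RV P >-> R})
  (a a' : bool)
  (* existence and finiteness of the displayed expectations *)
  (integrable_nested : P.-integrable [set: Omega]
     (fun t => (Yp a (Lp a t) (Mp a' (Lp a t) t) t)%:E))
  (finite_cexp_Y : forall l m : bool, {ae distribution P X, forall x,
     cexp_finite P Y [set t | [/\ A t = a, L t = l & M t = m]] X x})
  (consistency : {ae P, forall t, forall b l m : bool,
     A t = b -> L t = l -> M t = m ->
     [/\ Lp b t = L t, Mp b l t = M t & Yp b l m t = Y t]})
  (positivity : forall b l m : bool, {ae distribution P X, forall x,
     [/\ 0 < cprob P [set t | A t = b] setT X x,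
         0 < cprob P [set t | L t = l] [set t | A t = b] X x &
         0 < cprob P [set t | M t = m] [set t | A t = b /\ L t = l] X x]})
  (necessity_L : forall b : bool, {ae distribution P X, forall x,
     0 < cprob P [set t | SL t = false] setT X x ->
     cprob P [set t | Lp b t = true] [set t | SL t = false] X x = 0})
  (necessity_M : forall b l : bool, {ae distribution P X, forall x,
     0 < cprob P [set t | SM l t = false] setT X x ->
     cprob P [set t | Mp b l t = true] [set t | SM l t = false] X x = 0})
  (sufficiency_L : {ae distribution P X, forall x,
     0 < cprob P [set t | SL t = true] setT X x ->
     cprob P [set t | Lp a t = true] [set t | SL t = true] X x = 1})
  (sufficiency_M : forall l : bool, {ae distribution P X, forall x,
     0 < cprob P [set t | SM l t = true] setT X x ->
     cprob P [set t | Mp a' l t = true] [set t | SM l t = true] X x = 1})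
  (blinding : forall l : bool,
     cindep P (fun t => (SL t, SM l t)) A setT X)
  (marker_exch : forall l : bool,
     cindep P (SM l) L [set t | A t = a'] (fun t => (X t, SL t)))
  (stratum_pos_LM : forall l m : bool, {ae distribution P X, forall x,
     0 < cprob P [set t | SL t = l /\ SM l t = m] setT X x ->
     0 < cprob P [set t | [/\ A t = a, L t = l & M t = m]]
                 [set t | SL t = l /\ SM l t = m] X x})
  (stratum_pos_L : forall l : bool, {ae distribution P X, forall x,
     0 < cprob P [set t | SL t = l] setT X x ->
     0 < cprob P [set t | A t = a' /\ L t = l] [set t | SL t = l] X x})
  (exch_A : forall l m : bool,
     cindep P (Yp a l m) A setT (fun t => (X t, SL t, SM l t)))
  (exch_L : forall l m : bool,
     cindep P (Yp a l m) L [set t | A t = a]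
       (fun t => (X t, SL t, SM l t)))
  (exch_M : forall l m : bool,
     cindep P (Yp a l m) M [set t | A t = a /\ L t = l]
       (fun t => (X t, SL t, SM l t)))
  (mediator_marker : cindep P M SL setT (fun t => (A t, L t, X t)))
  (outcome_marker : forall l : bool,
     cindep P Y (fun t => (SL t, SM l t)) setT
       (fun t => (A t, L t, M t, X t))) :
  ('E_P[fun t => Yp a (Lp a t) (Mp a' (Lp a t) t) t])%E =
  (\int[distribution P X]_x
     (\sum_(l : bool) \sum_(m : bool)
        cexp P Y [set t | [/\ A t = a, L t = l & M t = m]] X x
        * cprob P [set t | M t = m] [set t | A t = a' /\ L t = l] X x
        * cprob P [set t | L t = l] [set t | A t = a] X x)%:E)%E.
Proof.
pose mark (V : {mfun Omega >-> bool}) b := [set t | V t = b].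
have mV (V : {mfun Omega >-> bool}) b : measurable (mark V b).
  by rewrite -[X in measurable X]/(V @^-1` [set b]); exact: measurable_funPTI.
pose S l m := mark SL l `&` mark (SM l) m.
pose F l m := mark A a `&` mark L l `&` mark M m.
pose q E := cprob0 P E X.
have mS l m : measurable (S l m) by exact: measurableI.
have mF l m : measurable (F l m) by do 2 apply: measurableI => //.
have FE l m : [set t | [/\ A t = a, L t = l & M t = m]] = F l m.
  by apply/seteqP; split => t [] => [At Lt Mt|[At Lt] Mt].
have q_ge0 E x : measurable E -> 0 <= q E x by move=> mE; exact: cprob0_ge0.
have LpE : {ae P, forall t, Lp a t = SL t}.
  exact: ae_eq_marker (necessity_L a) sufficiency_L.
have MpE l : {ae P, forall t, Mp a' l t = SM l t}.
  exact: ae_eq_marker (necessity_M a' l) (sufficiency_M l).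
have posA b : {ae distribution P X, forall x, 0 < q (mark A b) x}.
  have := ae_and (positivity b true true) (cprobTE P X (mV A b)).
  by apply: filterS => x [[+ _ _]] AE; rewrite AE.
have posL b l : {ae distribution P X, forall x, 0 < q (mark A b `&` mark L l) x}.
  apply: filterS (positivity b l true) => x [_ + _].
  move/numerator_gt0; rewrite setIC; apply.
  exact: q_ge0 (measurableI _ _ (mV A b) (mV L l)).
have posF l m : {ae distribution P X, forall x, 0 < q (F l m) x}.
  apply: filterS (positivity a l m) => x [_ _].
  move/numerator_gt0; rewrite setIC; apply.
  exact: q_ge0 (mF l m).
have consL : {ae P, forall t, A t = a -> L t = SL t}.
  apply: filterS (ae_and consistency LpE) => t [cons <-] At.
  by have [-> ] := cons _ _ _ At erefl erefl.
have consM l : {ae P, forall t, A t = a' -> L t = l -> M t = SM l t}.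
  apply: filterS (ae_and consistency (MpE l)) => t [cons <-] At Lt.
  by have [_ -> ] := cons _ _ _ At Lt erefl.
have consY l m : {ae P, forall t, A t = a -> L t = l -> M t = m ->
    Yp a l m t = Y t}.
  apply: filterS consistency => t cons At Lt Mt.
  by have [_ _ -> ] := cons _ _ _ At Lt Mt.
have stratL l : {ae distribution P X, forall x, 0 < q (mark SL l) x ->
    0 < q (mark A a' `&` mark L l `&` mark SL l) x}.
  have := ae_and (stratum_pos_L l) (cprobTE P X (mV SL l)).
  apply: filterS => x [+ SLE]; rewrite SLE => h /h /numerator_gt0; apply.
  exact: q_ge0 (measurableI _ _ (measurableI _ _ (mV A a') (mV L l)) (mV SL l)).
have stratLM l m : {ae distribution P X, forall x, 0 < q (S l m) x ->
    0 < q (F l m `&` S l m) x}.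
  have := ae_and (stratum_pos_LM l m) (cprobTE P X (mS l m)).
  apply: filterS => x [+ SE]; rewrite FE SE => h /h /numerator_gt0; apply.
  exact: q_ge0 (measurableI _ _ (mF l m) (mS l m)).
have weight l m := stratum_weight m (blinding l) (marker_exch l)
  mediator_marker consL (consM l) (posA a) (posA a') (posL a' l) (stratL l).
have outcome l m B (mB : measurable B) := stratum_outcome mB (exch_A l m)
  (exch_L l m) (exch_M l m) (outcome_marker l) (consY l m) (stratLM l m).
pose N t := Yp a (Lp a t) (Mp a' (Lp a t) t) t.
(* The index [Lp a t] of [Mp a'] is random, so both values of [l] in [MpE] are called for. *)
have NE : {ae P, forall t, N t = Yp a (SL t) (SM (SL t) t) t}.
  apply: filterS (ae_and LpE (ae_and (MpE true) (MpE false))) => t [lE [m1 m0]].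
  by rewrite /N lE; case: (SL t); rewrite ?m1 ?m0.
(* The positive part for [true] and the negative part for [false], as in [cexp]: the transfer from
   sets to functions is for nonnegative functions. *)
pose part (b : bool) (y : R) := Num.max (if b then y else - y) 0.
have part0 b y : 0 <= part b y by rewrite /part le_max lexx orbT.
have mpart b : measurable_fun setT (part b).
  by rewrite /part; case: b; apply: measurable_maxr; rewrite //; exact: measurable_id.
have partE y : part true y - part false y = y.
  rewrite /part /=; have [y0|y0] := leP 0 y.
    by rewrite max_r ?oppr_le0// subr0.
  by rewrite max_l ?oppr_ge0 ?ltW// sub0r opprK.
have part_le b y : part b y <= `|y|.
  by rewrite /part; case: b; rewrite ge_max normr_ge0 andbT ?ler_norm// ler_normr lexx orbT.
pose U b l m t := part b (Yp a l m t) * \1_(S l m) t.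
have mU b l m : measurable_fun setT (U b l m).
  apply: measurable_funM; last exact: measurable_indic.
  exact: measurableT_comp.
have U0 b l m t : 0 <= U b l m t by rewrite mulr_ge0.
(* On [S l m] the nested outcome is [Yp a l m], so its absolute value bounds [U]. *)
have Uoo b l m : (\int[P]_t (U b l m t)%:E < +oo)%E.
  have /integrableP[mN Noo] := integrable_nested.
  apply: le_lt_trans Noo; apply: ae_ge0_le_integral => //.
  - by move=> t _; rewrite lee_fin.
  - exact/measurable_EFinP.
  - exact: measurableT_comp.
  apply: filterS NE => t tE _; rewrite -/(N t) tE lee_fin /U indicE.
  have [/set_mem [/= -> ->]|_] := boolP (t \in S l m); last by rewrite mulr0.
  by rewrite mulr1.
have fineU b l m := integral_fine_cexp_ge0 X (mU b l m) (U0 b l m) (Uoo b l m).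
have iU b l m : P.-integrable setT (EFin \o U b l m).
  apply/integrableP; split; first exact/measurable_EFinP.
  by under eq_integral do rewrite /= ger0_norm//; exact: Uoo.
pose e b l m x := fine (cexp_ge0 P (EFin \o U b l m) X x).
(* Each [t] lies in exactly one stratum [S l m], so one pair survives in the double sum. *)
transitivity (\int[P]_t (\sum_(l : bool) \sum_(m : bool)
    (U true l m t - U false l m t))%:E)%E.
  rewrite unlock; apply: ae_eq_integral => //.
  - exact: measurable_int integrable_nested.
  - apply/measurable_EFinP; do 2 apply: measurable_sum => ?.
    exact: measurable_funB.
  apply: filterS NE => t tE _; congr EFin; rewrite -[LHS]/(N t) tE !big_bool /U.
  rewrite -!mulrBl !partE !indicE.
  have inS l m : (t \in S l m) = (SL t == l) && (SM l t == m).
    by apply/idP/andP => [/set_mem[/= -> ->]|[/eqP ? /eqP ?]]; [rewrite !eqxx|exact/mem_set].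
  rewrite !inS; case: (SL t) => /=; case: (SM _ t);
    by rewrite /= ?(mulr0, mulr1, addr0, add0r).
(* Each integral equals that of the conditional expectation given [X]; integrability allows
   splitting the sum and the differences. *)
transitivity (\int[distribution P X]_x (\sum_(l : bool) \sum_(m : bool)
    (e true l m x - e false l m x))%:E)%E.
  have ie b l m : (distribution P X).-integrable setT (EFin \o e b l m).
    by have [] := fineU b l m.
  rewrite (integral_sum2B (iU true) (iU false)).
  rewrite (integral_sum2B (ie true) (ie false)).
  apply: eq_bigr => l _; apply: eq_bigr => m _.
  have [_ _ pE] := fineU true l m; have [_ _ nE] := fineU false l m.
  by rewrite -pE -nE.
have me b l m : measurable_fun setT (e b l m).
  by have [_ /measurable_int /measurable_EFinP] := fineU b l m.
apply: ae_eq_integral => //.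
- apply/measurable_EFinP; do 2 apply: measurable_sum => ?.
  exact: measurable_funB.
- apply/measurable_EFinP; apply: measurable_sum => l; apply: measurable_sum => m.
  apply: measurable_funM; last by apply: measurable_cprob; exact: mV.
  apply: measurable_funM; first by rewrite FE; exact: measurable_cexp.
  apply: measurable_cprob; first exact: mV.
  exact: (measurableI _ _ (mV A a') (mV L l)).
suff term l m : {ae distribution P X, forall x,
    e true l m x - e false l m x =
    cexp P Y [set t | [/\ A t = a, L t = l & M t = m]] X x
    * cprob P [set t | M t = m] [set t | A t = a' /\ L t = l] X x
    * cprob P [set t | L t = l] [set t | A t = a] X x}.
  have := ae_and (ae_and (term true true) (term true false))
                 (ae_and (term false true) (term false false)).
  apply: filterS => x [[tt tf] [ft ff]] _.
  by rewrite !big_bool -tt -tf -ft -ff.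
(* Passes from Borel sets, covered by [outcome], to the two parts of the outcome. *)
have transfer b := cexp_ge0_transfer (measurable_funP (Yp a l m))
  (measurable_funP Y) (mS l m) (mF l m) (@outcome l m) (mpart b) (part0 b)
  (Uoo b l m).
have fin b : {ae distribution P X, forall x,
    cexp_ge0 P (EFin \o U b l m) X x \is a fin_num} by have [] := fineU b l m.
have := ae_and (weight l m) (ae_and (posF l m)
  (ae_and (ae_and (transfer true) (transfer false))
          (ae_and (fin true) (fin false)))).
apply: filterS => x [wE [qF [[trt trf] [ft ff]]]].
pose eY b := cexp_ge0 P (fun t => (part b (Y t) * \1_(F l m) t)%:E) X x.
have eU0 b : (0 <= cexp_ge0 P (EFin \o U b l m) X x)%E.
  have [|||_ + _] := @cexp_ge0P _ _ _ _ _ P X (EFin \o U b l m).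
  - exact/measurable_EFinP.
  - by move=> t; rewrite lee_fin.
  - by move=> t; exact: ltry.
  exact.
have eY0 b : (0 <= eY b)%E.
  have [|||_ + _] := @cexp_ge0P _ _ _ _ _ P X
    (fun t => (part b (Y t) * \1_(F l m) t)%:E).
  - apply/measurable_EFinP; apply: measurable_funM; last exact: measurable_indic.
    exact: measurableT_comp.
  - by move=> t; rewrite lee_fin mulr_ge0.
  - by move=> t; exact: ltry.
  exact.
have eE b : (cexp_ge0 P (EFin \o U b l m) X x * (q (F l m) x)%:E =
    eY b * (q (S l m) x)%:E)%E by case: b.
have finb b : cexp_ge0 P (EFin \o U b l m) X x \is a fin_num by case: b.
rewrite FE -mulrA.
(* By [weight], the two mediator factors multiply to [q (S l m) x]. *)
transitivity (cexp P Y (F l m) X x * q (S l m) x); last first.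
  by congr (_ * _); symmetry; exact: wE.
(* For each part, the transferred identity is divided by the positive [q (F l m) x]; the difference
   of the results is the [cexp] term. *)
rewrite /e -(fine_mul_eq (eU0 true) (eY0 true) (finb true) qF (q_ge0 _ _ (mS l m)) (eE true)).
rewrite -(fine_mul_eq (eU0 false) (eY0 false) (finb false) qF (q_ge0 _ _ (mS l m)) (eE false)).
by rewrite -mulrBl -mulrBl.
Qed.
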